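(* Let $w_i(x_1,\dots,x_k)$ and $u_i(x_1,\dots,x_k)$, $i=1,\dots,r$, be words in the letters $x_1,x_1^{-1},\dots,x_k,x_k^{-1}$, and let $G=\langle x_1,\dots,x_k \mid w_i(x_1,\dots,x_k)=u_i(x_1,\dots,x_k),\ i=1,\dots,r\rangle$. Then: (1) if the group $G$ is finite, then the system of equations $w_i(x_1,\dots,x_k)=u_i(x_1,\dots,x_k)$, $i=1,\dots,r$, is stable in permutations; (2) if the group $G$ is sofic but not residually finite, then the system of equations $w_i(x_1,\dots,x_k)=u_i(x_1,\dots,x_k)$, $i=1,\dots,r$, is unstable (i.e. not stable) in permutations.
   Context: $S_n$ denotes the group of all permutations of $\{1,\dots,n\}$, and for $f,g\in S_n$ the normalized Hamming distance is $h(f,g)=\frac{|\{a\in\{1,\dots,n\}: f(a)\ne g(a)\}|}{n}$. $\epsilon$-solution: permutations $f_1,\dots,f_k\in S_n$ are an $\epsilon$-solution of the system $w_i=u_i$, $i=1,\dots,r$, if $h(w_i(f_1,\dots,f_k),u_i(f_1,\dots,f_k))\le\epsilon$ for every $i=1,\dots,r$. They are an exact solution if $w_i(f_1,\dots,f_k)=u_i(f_1,\dots,f_k)$ for every $i$. Stability: the system is stable in permutations if there exists a function $\epsilon\mapsto\delta_\epsilon$ (defined for $\epsilon>0$, independent of $n$) with $\lim_{\epsilon\to 0}\delta_\epsilon=0$ such that for every $\epsilon>0$, every $n\ge 1$ and every $\epsilon$-solution $f_1,\dots,f_k\in S_n$ of the system there exists an exact solution $\tilde f_1,\dots,\tilde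 f_k\in S_n$ (same $n$) of the system with $h(f_i,\tilde f_i)<\delta_\epsilon$ for $i=1,\dots,k$. Sofic group: for a group $G$ with identity $e$, a finite subset $F\subseteq G$, $\epsilon\ge 0$ and $\alpha>0$, an $(F,\epsilon,\alpha)$-representation in $(S_n,h)$ is a map $\phi:F\to S_n$ such that (i) $h(\phi(a)\phi(b),\phi(ab))<\epsilon$ for all $a,b\in F$ with $ab\in F$; (ii) if $e\in F$ then $\phi(e)=\mathrm{id}$; (iii) $h(\phi(a),\mathrm{id})>\alpha$ for every $a\in F$ with $a\ne e$. The group $G$ is sofic if there exists $\alpha_0>0$ such that for every finite $F\subseteq G$ and every $\epsilon>0$ there exists an $(F,\epsilon,\alpha_0)$-representation in $(S_n,h)$ for some $n$. Residually finite: $G$ is residually finite if for every $g\in G$ with $g\ne e$ there is a homomorphism $\phi$ from $G$ to a finite group $H$ with $\phi(g)\ne e_H$. *)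

(* Defs.v *)
From HB Require Import structures.
From mathcomp Require Import all_boot all_order all_algebra all_fingroup.
From mathcomp Require Import all_classical all_reals all_analysis.
Import Order.TTheory GRing.Theory Num.Theory.
Import numFieldNormedType.Exports.

Set Implicit Arguments.
Unset Strict Implicit.
Unset Printing Implicit Defensive.

(* The letter (i, false) is x_i and the letter (i, true) is x_i^-1. *)
Definition word (k : nat) := seq ('I_k * bool).

Definition word_inv (k : nat) (a : word k) : word k :=
  rev [seq (l.1, ~~ l.2) | l <- a].

Section Evaluation.
Local Open Scope group_scope.

Definition weval (k : nat) (gT : groupType) (f : 'I_k -> gT) (a : word k) : gT :=
  \prod_(l <- a) (if l.2 then (f l.1)^-1 else f l.1).

End Evaluation.

Section Presentation.
Variables (k r : nat) (w u : 'I_r -> word k).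

(* The least monoid congruence on words that cancels x_i with x_i^-1 and
   identifies w_i with u_i. *)
Inductive word_cong : word k -> word k -> Prop :=
| word_cong_refl a : word_cong a a
| word_cong_sym a b : word_cong a b -> word_cong b a
| word_cong_trans b a c : word_cong a b -> word_cong b c -> word_cong a c
| word_cong_cat a a' b b' :
    word_cong a a' -> word_cong b b' -> word_cong (a ++ b) (a' ++ b')
| word_cong_cancel i s : word_cong [:: (i, s); (i, ~~ s)] [::]
| word_cong_rel i : word_cong (w i) (u i).

Definition word_congb (a b : word k) : bool := `[< word_cong a b >].

Lemma word_congb_refl : reflexive word_congb.
Proof. by move=> a; apply/asboolP; exact: word_cong_refl. Qed.

Lemma word_congb_sym : symmetric word_congb.
Proof. by move=> a b; apply/asboolP/asboolP => /word_cong_sym. Qed.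

Lemma word_congb_trans : transitive word_congb.
Proof.
move=> b a c /asboolP ab /asboolP bc; apply/asboolP.
exact: word_cong_trans ab bc.
Qed.

Canonical word_cong_equiv :=
  EquivRel word_congb word_congb_refl word_congb_sym word_congb_trans.

Definition presented_group := {eq_quot word_cong_equiv}%qT.

HB.instance Definition _ := Choice.on presented_group.
HB.instance Definition _ := EqQuotient.on presented_group.

Local Open Scope quotient_scope.
Local Notation G := presented_group.
Local Notation qrepr := (@generic_quotient.repr _ G).

Lemma presented_groupP (a b : word k) :
  word_cong a b <-> \pi_G a = \pi_G b.
Proof. by split=> [ab | /eqmodP/asboolP //]; apply/eqmodP/asboolP. Qed.

Lemma word_cong_repr (a : word k) : word_cong (qrepr (\pi_G a)) a.
Proof. by apply/presented_groupP; rewrite reprK. Qed.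

Lemma word_invK : involutive (@word_inv k).
Proof.
move=> a; rewrite /word_inv map_rev revK -map_comp -[RHS]map_id.
by apply: eq_map => -[i s] /=; rewrite negbK.
Qed.

Lemma word_inv_cat (a b : word k) :
  word_inv (a ++ b) = word_inv b ++ word_inv a.
Proof. by rewrite /word_inv map_cat rev_cat. Qed.

Lemma word_cong_mulV (a : word k) : word_cong (a ++ word_inv a) [::].
Proof.
elim: a => [|[i s] a IHa]; first exact: word_cong_refl.
rewrite -cat1s word_inv_cat -catA (catA a).
apply: word_cong_trans (word_cong_cancel i s).
apply: (@word_cong_cat [:: _] [:: _] _ [:: _]); first exact: word_cong_refl.
exact: (@word_cong_cat _ [::] _ [:: (i, ~~ s)] IHa (word_cong_refl _)).
Qed.

Lemma word_cong_mulVl (a : word k) : word_cong (word_inv a ++ a) [::].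
Proof. by rewrite -{2}[a]word_invK; exact: word_cong_mulV. Qed.

Lemma word_cong_inv (a b : word k) :
  word_cong a b -> word_cong (word_inv a) (word_inv b).
Proof.
move=> ab.
apply: (@word_cong_trans (word_inv a ++ (b ++ word_inv b))).
  rewrite -[X in word_cong X]cats0.
  apply: word_cong_cat (word_cong_refl _) _.
  exact/word_cong_sym/word_cong_mulV.
rewrite catA -[X in word_cong _ X]cat0s.
apply: word_cong_cat (word_cong_refl _).
apply: word_cong_trans (word_cong_mulVl a).
exact: word_cong_cat (word_cong_refl _) (word_cong_sym ab).
Qed.

Definition pg_one : G := \pi_G [::].
Definition pg_mul (x y : G) : G := \pi_G (qrepr x ++ qrepr y).
Definition pg_inv (x : G) : G := \pi_G (word_inv (qrepr x)).

Lemma pg_mulE (a b : word k) : pg_mul (\pi_G a) (\pi_G b) = \pi_G (a ++ b).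
Proof.
apply/presented_groupP.
exact: word_cong_cat (word_cong_repr _) (word_cong_repr _).
Qed.

Lemma pg_invE (a : word k) : pg_inv (\pi_G a) = \pi_G (word_inv a).
Proof.
by apply/presented_groupP; exact: word_cong_inv (word_cong_repr _).
Qed.

Lemma pg_mulA : associative pg_mul.
Proof.
elim/quotW=> a; elim/quotW=> b; elim/quotW=> c.
by rewrite (pg_mulE b c) (pg_mulE a b) (pg_mulE a) (pg_mulE _ c) catA.
Qed.

Lemma pg_mul1g : left_id pg_one pg_mul.
Proof. by elim/quotW=> a; rewrite (pg_mulE [::] a). Qed.

Lemma pg_mulg1 : right_id pg_one pg_mul.
Proof. by elim/quotW=> a; rewrite (pg_mulE a [::]) cats0. Qed.

Lemma pg_mulVg : left_inverse pg_one pg_inv pg_mul.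
Proof.
elim/quotW=> a; rewrite (pg_invE a) (pg_mulE (word_inv a) a).
exact/presented_groupP/word_cong_mulVl.
Qed.

Lemma pg_mulgV : right_inverse pg_one pg_inv pg_mul.
Proof.
elim/quotW=> a; rewrite (pg_invE a) (pg_mulE a (word_inv a)).
exact/presented_groupP/word_cong_mulV.
Qed.

HB.instance Definition _ :=
  isGroup.Build presented_group pg_mulA pg_mul1g pg_mulg1 pg_mulVg pg_mulgV.

End Presentation.

Section Hamming.
Local Open Scope ring_scope.

Definition hamming (R : realType) (n : nat) (f g : 'S_n) : R :=
  #|[pred a | f a != g a]|%:R / n%:R.

End Hamming.

Section Stability.
Local Open Scope classical_set_scope.
Local Open Scope ring_scope.
Variables (R : realType) (k r : nat) (w u : 'I_r -> word k).

Definition eps_solution (e : R) (n : nat) (f : 'I_k -> 'S_n) : Prop :=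
  forall i, hamming R (weval f (w i)) (weval f (u i)) <= e.

Definition exact_solution (n : nat) (f : 'I_k -> 'S_n) : Prop :=
  forall i, weval f (w i) = weval f (u i).

(* Only the values of delta at positive reals matter. *)
Definition stable_in_perms : Prop :=
  exists delta : R -> R,
    delta e @[e --> 0^'+] --> (0 : R) /\
    forall (e : R) (n : nat), 0 < e -> (0 < n)%N ->
    forall f : 'I_k -> 'S_n, eps_solution e f ->
    exists f' : 'I_k -> 'S_n,
      exact_solution f' /\ forall i, hamming R (f i) (f' i) < delta e.

End Stability.

Section GroupProperties.
Local Open Scope classical_set_scope.
Local Open Scope group_scope.

(* phi is total, but only its values on F are constrained. *)
Definition sofic_representation (R : realType) (G : groupType) (F : set G)
    (e alpha : R) (n : nat) (phi : G -> 'S_n) : Prop :=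
  [/\ forall a b, F a -> F b -> F (a * b) ->
        (hamming R (phi a * phi b)%g (phi (a * b)%g) < e)%R,
      F 1 -> phi 1 = 1
    & forall a, F a -> a != 1 -> (alpha < hamming R (phi a) 1%g)%R].

Definition sofic (R : realType) (G : groupType) : Prop :=
  exists2 alpha : R, (0 < alpha)%R &
    forall (F : set G) (e : R), finite_set F -> (0 < e)%R ->
    exists n : nat, (0 < n)%N /\
      exists phi : G -> 'S_n, sofic_representation F e alpha phi.

Definition residually_finite (G : groupType) : Prop :=
  forall g : G, g != 1 ->
  exists (H : finGroupType) (phi : {multiplicative G -> H}), phi g != 1.

End GroupProperties.

(* Main.v *)
(** Both parts rest on the Hamming distance being a bi-invariant metric: words
    that are congruent modulo the relations evaluate, on an [e]-solution, to
    permutations at distance [O(e)].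

    If [G] is finite, then finitely many consequences of the relations (a
    multiplication table of [G]) force every relation to hold along the whole
    orbit of a point.  These hold outside a set of density [O(e)], so the points
    whose orbits satisfy all the relations form an invariant set of density
    [1 - O(e)]; restricting the permutations to it, and letting them be the
    identity elsewhere, gives a nearby exact solution.

    If [G] is sofic and the system is stable, restrict an almost
    multiplicative map [phi] to the generators and correct it to an exact
    solution, that is, to a homomorphism from [G] to a finite group.  It stays
    close to [phi] on any prescribed nontrivial element, hence does not kill
    it, so [G] is residually finite. *)

From HB Require Import structures.
Require Import Defs.
From mathcomp Require Import all_boot all_order all_algebra all_fingroup.
From mathcomp Require Import all_classical all_reals all_analysis.
From mathcomp Require Import zify ring lra.
Import Order.TTheory GRing.Theory Num.Theory.
Import numFieldNormedType.Exports.

Set Implicit Arguments.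
Unset Strict Implicit.
Unset Printing Implicit Defensive.

(** * The normalized Hamming distance as a bi-invariant metric *)

Section HammingMetric.
Local Open Scope ring_scope.
Variables (R : realType) (n : nat).
Implicit Types f g x : 'S_n.

Lemma hamming_le_card (A : {set 'I_n}) f g :
  (forall a, a \notin A -> f a = g a) -> hamming R f g <= #|A|%:R / n%:R.
Proof.
move=> fg; rewrite ler_wpM2r ?invr_ge0 // ler_nat.
apply/subset_leq_card/fintype.subsetP => a; rewrite inE.
by apply: contraR => /fg->.
Qed.

Lemma hammingxx f : hamming R f f = 0.
Proof. by rewrite /hamming eq_card0 ?mul0r // => a; rewrite inE eqxx. Qed.

Lemma hammingC f g : hamming R f g = hamming R g f.
Proof.
by congr (_%:R / _); apply: eq_card => a; rewrite !inE eq_sym.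
Qed.

Let D f g := [set a | f a != g a]%SET.

Let hammingE f g : hamming R f g = #|D f g|%:R / n%:R.
Proof. by congr (_%:R / _); apply: eq_card => a; rewrite !inE. Qed.

Lemma hamming_triangle g f x : hamming R f x <= hamming R f g + hamming R g x.
Proof.
rewrite (hammingE f g) (hammingE g x) -mulrDl -natrD.
apply: (le_trans (hamming_le_card (A := D f g :|: D g x) _)) => [a|].
  by rewrite !inE negb_or !negbK => /andP[/eqP-> /eqP->].
by rewrite ler_wpM2r ?invr_ge0 // ler_nat leq_card_setU.
Qed.

Lemma hammingMl x f g : hamming R (x * f)%g (x * g)%g = hamming R f g.
Proof.
rewrite !hammingE -(card_preimset (D f g) (@perm_inj _ x)).
by congr (_%:R / _); apply: eq_card => a; rewrite !inE !permM.
Qed.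

Lemma hammingMr x f g : hamming R (f * x)%g (g * x)%g = hamming R f g.
Proof.
by congr (_%:R / _); apply: eq_card => a; rewrite !inE !permM (inj_eq perm_inj).
Qed.

Lemma hammingM f f' g g' :
  hamming R (f * g)%g (f' * g')%g <= hamming R f f' + hamming R g g'.
Proof.
by apply: le_trans (hamming_triangle (f' * g) _ _) _; rewrite hammingMl hammingMr.
Qed.

(** Multiplying by [f] on the left and by [g] on the right turns the two inverses into [g] and
    [f]. *)
Lemma hammingV f g : hamming R f^-1%g g^-1%g = hamming R f g.
Proof.
by rewrite -(hammingMl f) -(hammingMr g) mulgV mul1g mulgKV hammingC.
Qed.

End HammingMetric.

(** * Evaluation of words *)

Section WordEvaluation.
Local Open Scope group_scope.
Variable k : nat.

Lemma weval_nil (gT : groupType) (f : 'I_k -> gT) : weval f [::] = 1.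
Proof. exact: big_nil. Qed.

Lemma weval_cat (gT : groupType) (f : 'I_k -> gT) (a b : word k) :
  weval f (a ++ b) = weval f a * weval f b.
Proof. exact: big_cat. Qed.

Lemma weval_seq1 (gT : groupType) (f : 'I_k -> gT) l :
  weval f [:: l] = if l.2 then (f l.1)^-1 else f l.1.
Proof. exact: big_seq1. Qed.

Lemma weval_cons (gT : groupType) (f : 'I_k -> gT) l (a : word k) :
  weval f (l :: a) = weval f [:: l] * weval f a.
Proof. exact: weval_cat [:: l] a. Qed.

Lemma weval_cancel (gT : groupType) (f : 'I_k -> gT) i s :
  weval f [:: (i, s); (i, ~~ s)] = 1.
Proof.
by rewrite weval_cons !weval_seq1; case: s; rewrite /= ?mulVg ?mulgV.
Qed.

Lemma hamming_weval_seq1 (R : realType) n (f g : 'I_k -> 'S_n) l :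
  hamming R (weval f [:: l]) (weval g [:: l]) = hamming R (f l.1) (g l.1).
Proof. by rewrite !weval_seq1; case: l => i [] //=; rewrite hammingV. Qed.

Lemma hamming_weval (R : realType) n (f g : 'I_k -> 'S_n) (d : R) a :
  (forall i, hamming R (f i) (g i) <= d)%R ->
  (hamming R (weval f a) (weval g a) <= (size a)%:R * d)%R.
Proof.
move=> fg; elim: a => [|l a IHa]; first by rewrite !weval_nil hammingxx mul0r.
rewrite (weval_cons f) (weval_cons g) (le_trans (hammingM _ _ _ _ _)) //.
by rewrite hamming_weval_seq1 /= -natr1 mulrDl mul1r addrC lerD.
Qed.

End WordEvaluation.

(** * Consequences of the relations on exact and approximate solutions *)

Section Presentation.
Variables (R : realType) (k r : nat) (w u : 'I_r -> word k).
Local Notation G := (presented_group w u).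
Local Notation cls := (\pi_G%qT).

Lemma word_cong_weval n (f : 'I_k -> 'S_n) a b :
  exact_solution w u f -> word_cong w u a b -> weval f a = weval f b.
Proof.
move=> fwu; elim=> {a b} //.
- by move=> b a c _ -> _ ->.
- by move=> a a' b b' _ aa' _ bb'; rewrite !weval_cat aa' bb'.
- by move=> i s; rewrite weval_cancel weval_nil.
Qed.

(** Induction on the derivation: each use of a relation costs [e], and costs add along transitivity
    and concatenation. Hence [C] depends on the derivation only, not on [n], [f] or [e]. *)
Lemma word_cong_hamming a b : word_cong w u a b ->
  exists C : R, forall e n (f : 'I_k -> 'S_n), eps_solution w u e f ->
    (hamming R (weval f a) (weval f b) <= C * e)%R.
Proof.
elim=> {a b}.
- by move=> a; exists 0%R => e n f _; rewrite hammingxx mul0r.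
- by move=> a b _ [C abC]; exists C => e n f /abC; rewrite hammingC.
- move=> b a c _ [C abC] _ [D bcD]; exists (C + D)%R => e n f fe.
  rewrite mulrDl (le_trans (hamming_triangle _ (weval f b) _ _)) //.
  by rewrite lerD ?abC ?bcD.
- move=> a a' b b' _ [C aaC] _ [D bbD]; exists (C + D)%R => e n f fe.
  by rewrite mulrDl !weval_cat (le_trans (hammingM _ _ _ _ _)) ?lerD ?aaC ?bbD.
- by move=> i s; exists 0%R => e n f _; rewrite weval_cancel weval_nil hammingxx mul0r.
- by move=> i; exists 1%R => e n f fe; rewrite mul1r.
Qed.

Definition bad_points n (f : 'I_k -> 'S_n) (L : seq (word k * word k)) :=
  [set p | has (fun ab => weval f ab.1 p != weval f ab.2 p) L]%SET.

Lemma bad_points_bound (L : seq (word k * word k)) :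
  (forall ab, ab \in L -> word_cong w u ab.1 ab.2) ->
  exists C : R, forall e n (f : 'I_k -> 'S_n), eps_solution w u e f ->
    (#|bad_points f L|%:R / n%:R <= C * e)%R.
Proof.
elim: L => [|ab L IHL] Lwu.
  by exists 0%R => e n f _; rewrite eq_card0 ?mul0r // => p; rewrite inE.
have [b bL|C hC] := IHL; first by apply: Lwu; rewrite inE bL orbT.
have [|D hD] := @word_cong_hamming ab.1 ab.2; first by apply: Lwu; rewrite mem_head.
exists (D + C)%R => e n f fe; rewrite mulrDl.
apply: le_trans (lerD (hD _ _ _ fe) (hC _ _ _ fe)).
rewrite -mulrDl -natrD ler_wpM2r ?invr_ge0 // ler_nat.
pose A := [set p | weval f ab.1 p != weval f ab.2 p]%SET.
have -> : bad_points f (ab :: L) = A :|: bad_points f L.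
  by apply/setP=> p; rewrite !inE.
apply: (leq_trans (leq_card_setU _ _)); rewrite leq_add2r.
by apply/subset_leq_card/fintype.subsetP => p; rewrite !inE.
Qed.

(** Quantifying over all words [a] asks for the relations on the whole orbit of [p], which makes the
    set invariant. *)
Definition good_points n (f : 'I_k -> 'S_n) :=
  [set p | `[< forall a i,
     weval f (w i) (weval f a p) = weval f (u i) (weval f a p) >]]%SET.

Definition restrict_to_good n (f : 'I_k -> 'S_n) i : 'S_n :=
  restr_perm (good_points f) (f i).

Lemma good_points_weval n (f : 'I_k -> 'S_n) a p :
  p \in good_points f -> weval f a p \in good_points f.
Proof.
rewrite !inE => /asboolP fp; apply/asboolP => b i.
by have := fp (a ++ b) i; rewrite weval_cat !permM.
Qed.

(** Outside the normaliser [restr_perm] returns the identity; this invariance is what makes it agree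
    with [f i] on the good points. *)
Lemma good_points_norm n (f : 'I_k -> 'S_n) i :
  f i \in ('N(good_points f | 'P))%g.
Proof.
apply/astabsP => p /=.
apply/idP/idP => [/(good_points_weval [:: (i, true)]) |
                  /(good_points_weval [:: (i, false)])].
  by rewrite weval_seq1 apermE permK.
by rewrite weval_seq1.
Qed.

Lemma restrict_to_good_in n (f : 'I_k -> 'S_n) a p :
  p \in good_points f -> weval (restrict_to_good f) a p = weval f a p.
Proof.
elim: a p => [|[i s] a IHa] p fp; first by rewrite !weval_nil.
rewrite (weval_cons f) (weval_cons (restrict_to_good f)) !permM.
have -> : weval (restrict_to_good f) [:: (i, s)] p = weval f [:: (i, s)] p.
  rewrite !weval_seq1 /= /restrict_to_good; have nf := good_points_norm f i.
  case: s; last by rewrite restr_permE.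
  by rewrite -morphV // restr_permE // groupV.
exact/IHa/good_points_weval.
Qed.

Lemma restrict_to_good_out n (f : 'I_k -> 'S_n) a p :
  p \notin good_points f -> weval (restrict_to_good f) a p = p.
Proof.
move=> fp; have out i : restrict_to_good f i p = p.
  exact: out_perm (restr_perm_on _ _) fp.
elim: a => [|[i s] a IHa]; first by rewrite weval_nil perm1.
rewrite weval_cons permM weval_seq1 /=.
suff -> : (if s then (restrict_to_good f i)^-1%g else restrict_to_good f i) p = p.
  by [].
by case: s; rewrite ?out // -{1}(out i) permK.
Qed.

Lemma restrict_to_good_exact n (f : 'I_k -> 'S_n) :
  exact_solution w u (restrict_to_good f).
Proof.
move=> i; apply/permP => p.
have [fp|fp] := boolP (p \in good_points f); last first.
  by rewrite !restrict_to_good_out.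
rewrite !restrict_to_good_in //; move: fp; rewrite inE => /asboolP/(_ [::] i).
by rewrite weval_nil perm1.
Qed.

(** * Finite groups: stability *)

Section FiniteGroup.
Local Open Scope classical_set_scope.
Hypothesis finG : finite_set [set: G].

Lemma mult_table : exists2 L : seq (word k * word k),
  (forall ab, ab \in L -> word_cong w u ab.1 ab.2) &
  forall n (f : 'I_k -> 'S_n) p, p \notin bad_points f L -> p \in good_points f.
Proof.
have [s sG] := (finite_seqP _).1 finG.
have inG x : x \in s by have : [set` s] x by rewrite -sG.
pose rp := @generic_quotient.repr _ G.
(* The Cayley graph of [G] in terms of chosen representatives; the first pair is there because the
   representative of the identity may be a nonempty word. *)
pose L := ([::], rp (cls [::])) ::
  [seq (rp x ++ [:: l], rp (cls (rp x ++ [:: l]))) | x <- s, l <- enum {: 'I_k * bool}].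
exists L.
  move=> ab; rewrite inE => /orP[/eqP->|/allpairsP[[x l] [_ _ ->]]];
  exact/word_cong_sym/word_cong_repr.
move=> n f p; rewrite inE -all_predC => /allP fp.
(* At such a point the value of a word depends only on its class: append letters one at a time, each
   step being an entry of [L]. *)
have fE a : weval f a p = weval f (rp (cls a)) p.
  elim/last_ind: a => [|a l IHa].
    by have /= /negPn/eqP := fp _ (mem_head _ _).
  rewrite -cats1 weval_cat permM IHa -permM -weval_cat.
  have -> : cls (a ++ [:: l]) = cls (rp (cls a) ++ [:: l]).
    apply/presented_groupP/word_cong_cat; last exact: word_cong_refl.
    exact/word_cong_sym/word_cong_repr.
  apply/eqP/negPn.
  apply: (fp (rp (cls a) ++ [:: l], rp (cls (rp (cls a) ++ [:: l])))).
  rewrite inE; apply/orP; right.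
  by apply/allpairsP; exists (cls a, l); rewrite mem_enum.
rewrite inE; apply/asboolP => a i.
rewrite -!permM -!weval_cat (fE (a ++ w i)) (fE (a ++ u i)).
suff -> : cls (a ++ w i) = cls (a ++ u i) by [].
apply/presented_groupP/word_cong_cat; first exact: word_cong_refl.
exact: word_cong_rel.
Qed.

Lemma finite_stable : stable_in_perms R w u.
Proof.
have [L /bad_points_bound[C hC] Lgood] := mult_table.
(* The summand 1 turns the bound [C * e] into the required strict inequality. *)
exists (fun e => (C + 1) * e)%R; split.
  apply: cvg_at_right_filter.
  rewrite -[X in _ --> X](mulr0 (C + 1)%R); exact: mulrl_continuous.
move=> e n e0 _ f fe; exists (restrict_to_good f).
split=> [|i]; first exact: restrict_to_good_exact.
apply: (@le_lt_trans _ _ (C * e)%R); last by rewrite ltr_pM2r // ltrDl.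
apply: le_trans (hC _ _ _ fe); apply: hamming_le_card => p /Lgood fp.
have := restrict_to_good_in [:: (i, false)] fp.
by rewrite !weval_seq1.
Qed.

End FiniteGroup.

(** * Almost multiplicative maps restricted to the generators *)

Section SoficRestriction.
Variables (N n : nat) (phi : G -> 'S_n) (e : R).
Hypotheses (N_gt1 : (1 < N)%N)
  (phiM : forall a b, (size a <= N)%N -> (size b <= N)%N -> (size (a ++ b) <= N)%N ->
     (hamming R (phi (cls a) * phi (cls b))%g (phi (cls (a ++ b))) < e)%R)
  (phi1 : phi (cls [::]) = 1%g).

Let f i := phi (cls [:: (i, false)]).

Lemma sofic_letter l : (hamming R (weval f [:: l]) (phi (cls [:: l])) <= e)%R.
Proof.
have N_gt0 : (0 < N)%N by exact: ltnW.
case: l => i s; rewrite weval_seq1 /= /f.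
have e_ge0 : (0 <= e)%R.
  by have /ltW := @phiM [::] [::] (ltnW N_gt0) (ltnW N_gt0) (ltnW N_gt0);
     rewrite phi1 mulg1 hammingxx.
case: s; last by rewrite hammingxx.
set x := (i, true); set y := (i, false).
have xy : cls ([:: x] ++ [:: y]) = cls [::].
  exact/presented_groupP/(word_cong_cancel w u i true).
(* The product of the images of an inverse letter and its letter is [e]-close to the identity;
   cancel the second factor. *)
have /ltW := @phiM [:: x] [:: y] N_gt0 N_gt0 N_gt1.
by rewrite xy phi1 -(hammingMr _ (phi (cls [:: y]))^-1%g) mulgK mul1g hammingC.
Qed.

(** Each letter costs [2 * e]: once to replace its value by its image under [phi], once to multiply
    it into the rest. *)
Lemma sofic_word a : (size a <= N)%N ->
  (hamming R (weval f a) (phi (cls a)) <= (size a)%:R * (2 * e))%R.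
Proof.
elim: a => [_|l a IHa aN]; first by rewrite weval_nil phi1 hammingxx mul0r.
have /IHa {}IHa : (size a <= N)%N by exact: ltnW.
have /ltW hl := @phiM [:: l] a (ltnW N_gt1) (ltnW aN) aN.
rewrite weval_cons -[l :: a]cat1s.
apply: le_trans (hamming_triangle _ (phi (cls [:: l]) * phi (cls a))%g _ _) _.
have := hammingM R (weval f [:: l]) (phi (cls [:: l])) (weval f a) (phi (cls a)).
have := sofic_letter l.
by rewrite /= -natr1; move: hl IHa; lra.
Qed.

End SoficRestriction.

(** * From exact solutions to homomorphisms, and residual finiteness *)

Section InducedMorphism.
Variables (n : nat) (f : 'I_k -> 'S_n).
Hypothesis fwu : exact_solution w u f.

Definition induced_morphism (x : G) : 'S_n :=
  weval f (@generic_quotient.repr _ G x).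

Lemma induced_morphismE a : induced_morphism (cls a) = weval f a.
Proof. exact/(word_cong_weval fwu)/word_cong_repr. Qed.

Lemma induced_morphismM :
  {morph induced_morphism : x y / (x * y)%g >-> (x * y)%g}.
Proof.
move=> x y; rewrite -[x]reprK -[y]reprK.
by rewrite [(_ * _)%g in LHS]pg_mulE !induced_morphismE weval_cat.
Qed.

End InducedMorphism.

Lemma finite_short_words N :
  finite_set [set cls a | a in [set a : word k | (size a <= N)%N]]%classic.
Proof.
apply: finite_image.
rewrite (_ : [set a | _]%classic = range (@bseqval N ('I_k * bool)%type)).
  exact/finite_image/finite_finset.
apply/seteqP; split => [a /= aN|_ [a _ <-]]; last exact: size_bseq.
by exists (Bseq aN).
Qed.

Lemma sofic_stable_residually_finite :
  sofic R G -> stable_in_perms R w u -> residually_finite G.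
Proof.
move=> [al al0 soficG] [de [de0 stab]]; elim/quotW => v v1.
(* [N] bounds the lengths of [v] and of all relation words, and exceeds 1 so that two-letter words
   are covered. *)
pose N := (size v + \sum_i (size (w i) + size (u i))).+2.
have wN i : (size (w i) <= N)%N by rewrite /N (bigD1 i) //=; lia.
have uN i : (size (u i) <= N)%N by rewrite /N (bigD1 i) //=; lia.
have vN : (size v <= N)%N by rewrite /N; lia.
have N0 : (0 < N%:R :> R)%R by rewrite ltr0n.
set d := (al / (4 * N%:R))%R.
have d0 : (0 < d)%R by rewrite divr_gt0 // mulr_gt0.
have [e [e0 ed]] := filter_ex (filterI (nbhs_right_gt 0%R) (cvgr_lt _ de0 _ d0)).
(* Words of length at most [N] then err by at most half of [Num.min e al]: two such errors stay
   within [e], and one stays within [al / 2]. *)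
set e' := (Num.min e al / (4 * N%:R))%R.
have e'0 : (0 < e')%R by rewrite divr_gt0 ?mulr_gt0 // lt_min e0.
have Nd : (N%:R * d = al / 4)%R by rewrite /d; field; rewrite gt_eqF.
have Ne' : (N%:R * (2 * e') = Num.min e al / 2)%R.
  by rewrite /e'; field; rewrite gt_eqF.
have [mine minal] : (Num.min e al <= e)%R /\ (Num.min e al <= al)%R.
  by rewrite !ge_min !lexx orbT.
have [n [n0 [phi [phiM phi1 phial]]]] := soficG _ _ (finite_short_words N) e'0.
pose f i := phi (cls [:: (i, false)]).
have short a : (size a <= N)%N ->
    (hamming R (weval f a) (phi (cls a)) <= N%:R * (2 * e'))%R.
  move=> aN; have N1 : (1 < N)%N by [].
  apply: (le_trans (sofic_word (phi := phi) (e := e') N1 _ _ aN)).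
  - move=> b c bN cN bcN; rewrite -(pg_mulE w u b c).
    apply: phiM; first by exists b.
      by exists c.
    by exists (b ++ c) => //; rewrite -pg_mulE.
  - by apply: phi1; exists [::].
  - by rewrite ler_wpM2r ?ler_nat // mulr_ge0 // ltW.
have fe : eps_solution w u e f.
  move=> i; have := short _ (wN i); have := short _ (uN i).
  have -> : cls (w i) = cls (u i) by exact/presented_groupP/word_cong_rel.
  have := hamming_triangle R (phi (cls (u i))) (weval f (w i)) (weval f (u i)).
  by rewrite (hammingC _ (phi _) (weval _ _)) Ne'; lra.
have [f' [f'wu ff']] := stab e n e0 n0 f fe.
pose M := isMultiplicative.Build _ _ _ (induced_morphismM f'wu).
pose psi : {multiplicative G -> 'S_n} := HB.pack (induced_morphism f') M.
(* If [psi] killed [v], then [phi (cls v)] would be within [al / 2 + al / 4] of the identity,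
   against the separation by [al]. *)
exists 'S_n, psi; apply/eqP; rewrite /= induced_morphismE // => f'v.
have := phial (cls v) (ex_intro2 _ _ v vN erefl) v1.
have := short _ vN.
have ff'd i : (hamming R (f i) (f' i) <= d)%R by exact/ltW/(lt_trans (ff' i)).
have := hamming_weval v ff'd; rewrite f'v.
have : ((size v)%:R * d <= N%:R * d)%R by rewrite ler_wpM2r ?ler_nat // ltW.
have := hamming_triangle R (weval f v) (phi (cls v)) 1%g.
by rewrite (hammingC _ (phi _) (weval _ _)) Ne' Nd; lra.
Qed.

End Presentation.

Theorem theorem2 (R : realType) (k r : nat) (w u : 'I_r -> word k) :
  (finite_set [set: presented_group w u]%classic -> stable_in_perms R w u) /\
  (sofic R (presented_group w u) -> ~ residually_finite (presented_group w u) ->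
   ~ stable_in_perms R w u).
Proof.
split=> [|soficG nrf stab]; first exact: finite_stable.
exact/nrf/(sofic_stable_residually_finite soficG stab).
Qed.
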